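(* Let $D$ be an integral domain and $\star$ a semistar operation on $D$. The following are equivalent: (i) for every overring $T$ of $D$ and every semistar operation $\star'$ on $T$ such that $T$ is $(\star,\star')$-linked to $D$, the ring $T^{\widetilde{\star'}}$ is integrally closed; (ii) for every overring $T$ of $D$, $T^{\ell_{\star,T}}$ is integrally closed; (iii) every overring of $D$ that is $t$-linked to $(D,\star)$ is integrally closed; (iv) every overring $T$ of $D$ that is $(\star,d_T)$-linked to $D$ is integrally closed; (v) $D^{\tilde\star}$ is integrally closed and, for every overring $T$ and every semistar operation $\star'$ on $T$ such that $T$ is $(\star,\star')$-linked to $D$, $T^{\widetilde{\star'}}$ is seminormal; (vi) $D^{\tilde\star}$ is integrally closed and every overring of $D$ that is $t$-linked to $(D,\star)$ is seminormal; (vii) $D^{\tilde\star}$ is integrally closed and every overring $T$ of $D$ that is $(\star,d_T)$-linked to $D$ is seminormal; (viii) $D$ is a P$\star$MD.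
   Context: Let $D$ be an integral domain with quotient field $K$. $\overline{\mathbf F}(D)$ denotes the set of all nonzero $D$-submodules of $K$ and $\mathbf f(D)$ the set of nonzero finitely generated $D$-submodules of $K$. A semistar operation on $D$ is a map $\star:\overline{\mathbf F}(D)\to\overline{\mathbf F}(D)$, $E\mapsto E^\star$, such that for all $0\ne x\in K$ and $E,F\in\overline{\mathbf F}(D)$: (1) $(xE)^\star=xE^\star$; (2) $E\subseteq F\Rightarrow E^\star\subseteq F^\star$; (3) $E\subseteq E^\star$ and $(E^\star)^\star=E^\star$. $\star_f$ is defined by $E^{\star_f}=\bigcup\{F^\star:F\in\mathbf f(D),F\subseteq E\}$. A nonzero ideal $I$ of $D$ is a quasi-$\star$-ideal if $I^\star\cap D=I$; a quasi-$\star$-prime is a prime quasi-$\star$-ideal; a quasi-$\star$-maximal ideal is a maximal element among proper quasi-$\star$-ideals; $\mathcal M(\star_f)$ is the set of quasi-$\star_f$-maximal ideals and $E^{\tilde\star}=\bigcap\{ED_Q:Q\in\mathcal M(\star_f)\}$ (equal to $K$ if $\mathcal M(\star_f)=\emptyset$). An overring of $D$ is a ring $T$ with $D\subseteq T\subseteq K$; all notions are defined analogously on $T$. $d_T$ is the identity operation on $T$; $v_T$ is $E\mapsto(T:_K(T:_KE))$ and $t_T:=(v_T)_f$. $T$ is $(\star,\star')$-linked to $D$ if for every nonzero finitely generated ideal $F\subseteq D$ with $F^\star=D^\star$ one has $(FT)^{\star'}=T^{\star'}$; $T$ is $t$-linked to $(D,\star)$ if it is $(\star,t_T)$-linked to $D$.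 The semistar operation $\ell_{\star,T}$ on $T$ is $E^{\ell_{\star,T}}=\bigcap\{ET_{D\setminus P}:P$ a quasi-$\star_f$-prime of $D\}$. $D$ is a P$\star$MD (Prüfer $\star$-multiplication domain) if every $F\in\mathbf f(D)$ satisfies $(FF^{-1})^{\star_f}=D^\star$, where $F^{-1}=(D:_KF)$. A domain $R$ with quotient field $K$ is seminormal if every $x\in K$ with $x^2,x^3\in R$ lies in $R$. *)

(* Defs.v *)
From HB Require Import structures.
From mathcomp Require Import all_boot all_algebra.
From mathcomp Require Import boolp classical_sets.
Set Implicit Arguments. Unset Strict Implicit. Unset Printing Implicit Defensive.
Import GRing.Theory.
Local Open Scope classical_set_scope.
Local Open Scope ring_scope.

Section Defs.
Variable K : fieldType.
Implicit Types (D T R E F I Q : set K) (star : set K -> set K).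

Definition subring T :=
  T 0 /\ T 1 /\ (forall x y, T x -> T y -> T (x - y)) /\
  (forall x y, T x -> T y -> T (x * y)).

Definition quotfield D :=
  forall x : K, exists a b, D a /\ D b /\ b != 0 /\ x = a / b.

Definition overring D T := subring T /\ D `<=` T.

Definition submod T E :=
  E 0 /\ (forall x y, E x -> E y -> E (x + y)) /\
  (forall t x, T t -> E x -> E (t * x)).
Definition nzmod T E := submod T E /\ exists x, E x /\ x != 0.

Definition span T (s : seq K) : set K :=
  [set x | exists c : nat -> K, (forall i, T (c i)) /\
     x = \sum_(i < size s) c i * s`_i].
Definition fgmod T F := exists s : seq K, F = span T s.

Definition scale (x : K) E : set K := [set x * e | e in E].

Definition semistar T star :=
  (forall E, nzmod T E -> nzmod T (star E)) /\
  (forall (x : K) E, x != 0 -> nzmod T E -> star (scale x E) = scale x (star E)) /\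
  (forall E F, nzmod T E -> nzmod T F -> E `<=` F -> star E `<=` star F) /\
  (forall E, nzmod T E -> E `<=` star E) /\
  (forall E, nzmod T E -> star (star E) = star E).

Definition starf T star (E : set K) : set K :=
  [set x | exists F, fgmod T F /\ nzmod T F /\ F `<=` E /\ star F x].

Definition ideal T I := I `<=` T /\ submod T I.
Definition quasi_ideal T star I :=
  ideal T I /\ (exists x, I x /\ x != 0) /\ star I `&` T = I.
Definition proper I := ~ I 1.
Definition quasi_prime T star P :=
  quasi_ideal T star P /\ proper P /\
  (forall a b, T a -> T b -> P (a * b) -> P a \/ P b).
Definition quasi_max T star Q :=
  quasi_ideal T star Q /\ proper Q /\
  (forall J, quasi_ideal T star J -> proper J -> Q `<=` J -> J = Q).

Definition loc E (S : set K) : set K :=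
  [set x | exists e s, E e /\ S s /\ s != 0 /\ x = e / s].

(* star-tilde on T: intersection over quasi-star_f-maximal ideals (= K if none) *)
Definition stilde T star (E : set K) : set K :=
  [set x | forall Q, quasi_max T (starf T star) Q -> loc E (T `\` Q) x].

Definition lstar D star T (E : set K) : set K :=
  [set x | forall P, quasi_prime D (starf D star) P -> loc E (D `\` P) x].

Definition colon T E : set K := [set x | forall e, E e -> T (x * e)].
Definition vop T (E : set K) : set K := colon T (colon T E).
Definition top T := starf T (vop T).
Definition dop (E : set K) : set K := E.

Definition linked D star T (star' : set K -> set K) :=
  forall s : seq K, (forall x, x \in s -> D x) ->
    (exists x, span D s x /\ x != 0) ->
    star (span D s) = star D -> star' (span T s) = star' T.

Definition integral R (x : K) :=
  exists (n : nat) (c : nat -> K), (forall i, (i < n)%N -> R (c i)) /\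
    x ^+ n + \sum_(i < n) c i * x ^+ i = 0.
Definition integrally_closed R := forall x, integral R x -> R x.
Definition seminormal R := forall x : K, R (x ^+ 2) -> R (x ^+ 3) -> R x.

Definition prodset E F : set K :=
  [set x | exists (n : nat) (a b : nat -> K),
     (forall i, (i < n)%N -> E (a i) /\ F (b i)) /\ x = \sum_(i < n) a i * b i].

Definition PstarMD D star :=
  forall F, fgmod D F -> nzmod D F ->
    starf D star (prodset F (colon D F)) = star D.

End Defs.

(* Main.v *)
(** Call a finitely generated ideal [J] of [D] with [J^star = D^star] a GV ideal.
A nonzero ideal containing no GV ideal lies in a quasi-[star_f]-maximal ideal, and
such ideals are prime; hence both [E^~star] and [E^l] consist of the [x] with
[x J] inside [E] for some GV ideal [J]. So [T] is [t]-linked exactly when it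
contains every [x] with [x J] inside [T], and all versions of the integral
closedness condition reduce to localizations [T_N], which are [d]-linked.

Conversely every overring of [D_Q], for [Q] quasi-[star_f]-maximal, is [d]-linked,
hence seminormal, so every [x] lies in [D_Q[x^2, x^3]] and is a root of a
polynomial over [D_Q] with linear coefficient [-1]. As [D_Q] is local and
integrally closed, it contains [x] or [1/x]; being valuation rings, the [D_Q]
make [F F^-1] escape every [Q]. Finally, in a P-star-MD the localizations [T_N]
are valuation rings, thus integrally closed. *)

From mathcomp Require Import all_boot all_algebra.
From mathcomp Require Import boolp classical_sets.
From mathcomp Require Import ring.
Require Import Defs.
Set Implicit Arguments. Unset Strict Implicit. Unset Printing Implicit Defensive.
Import GRing.Theory.
Local Open Scope classical_set_scope.
Local Open Scope ring_scope.

(** * Submodules of [K] and spans of finite lists *)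

Section Submodules.
Variable K : fieldType.
Implicit Types (D T R V E F I J P Q S : set K) (star : set K -> set K).
Implicit Types (s t : seq K) (x y : K).

Lemma subring0 T : subring T -> T 0. Proof. by case. Qed.

Lemma subring1 T : subring T -> T 1. Proof. by case=> _ []. Qed.

Lemma subringB T x y : subring T -> T x -> T y -> T (x - y).
Proof. by case=> _ [_ [h _]]; apply: h. Qed.

Lemma subringM T x y : subring T -> T x -> T y -> T (x * y).
Proof. by case=> _ [_ [_ h]]; apply: h. Qed.

Lemma subringN T x : subring T -> T x -> T (- x).
Proof. by move=> hT hx; rewrite -sub0r; apply: subringB => //; apply: subring0. Qed.

Lemma subringD T x y : subring T -> T x -> T y -> T (x + y).
Proof. by move=> hT hx hy; rewrite -[y]opprK; apply: subringB => //; apply: subringN. Qed.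

Lemma subringX T x n : subring T -> T x -> T (x ^+ n).
Proof.
move=> hT hx; elim: n => [|n IH]; first by rewrite expr0; apply: subring1.
by rewrite exprS; apply: subringM.
Qed.

Lemma submod_self T : subring T -> submod T T.
Proof.
move=> hT; split; [exact: subring0 | split=> x y].
  exact: subringD.
exact: subringM.
Qed.

Lemma submod_sum T E n (f : nat -> K) : submod T E ->
  (forall i, (i < n)%N -> E (f i)) -> E (\sum_(i < n) f i).
Proof.
move=> [h0 [hD _]] hf; apply: (big_ind E) => //.
by move=> i _; apply: hf.
Qed.

Lemma subring_sum T n (f : nat -> K) : subring T ->
  (forall i, (i < n)%N -> T (f i)) -> T (\sum_(i < n) f i).
Proof. by move=> hT; apply: submod_sum (submod_self hT). Qed.

Lemma submod_weaken D T E : D `<=` T -> submod T E -> submod D E.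
Proof. by move=> DT [h0 [hD hM]]; split=> //; split=> // t x /DT; apply: hM. Qed.

Lemma submod_scale T E x : submod T E -> submod T (scale x E).
Proof.
move=> [h0 [hD hM]]; split; first by exists 0; rewrite ?mulr0.
split=> [_ _ [a ha <-] [b hb <-]|t _ ht [a ha <-]].
  by exists (a + b); [apply: hD | rewrite mulrDr].
by exists (t * a); [apply: hM | rewrite mulrCA].
Qed.

Lemma nzmod_scale T E x : x != 0 -> nzmod T E -> nzmod T (scale x E).
Proof.
move=> x0 [hE [e [he e0]]]; split; first exact: submod_scale.
by exists (x * e); split; [exists e | rewrite mulf_neq0].
Qed.

Lemma nzmod_self T : subring T -> nzmod T T.
Proof.
move=> hT; split; first exact: submod_self.
by exists 1; split; [exact: subring1 | exact: oner_neq0].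
Qed.

Lemma submod_span T s : subring T -> submod T (span T s).
Proof.
move=> hT; split.
  exists (fun=> 0); split=> [_|]; first exact: subring0.
  by rewrite big1 // => i _; rewrite mul0r.
split=> [_ _ [c [hc ->]] [d [hd ->]]|t _ ht [c [hc ->]]].
  exists (fun i => c i + d i); split=> [i|]; first exact: subringD.
  by rewrite -big_split; apply: eq_bigr => i _; rewrite mulrDl.
exists (fun i => t * c i); split=> [i|]; first exact: subringM.
by rewrite mulr_sumr; apply: eq_bigr => i _; rewrite mulrA.
Qed.

Lemma mem_span T s x : subring T -> x \in s -> span T s x.
Proof.
move=> hT xs; have hi : (index x s < size s)%N by rewrite index_mem.
(* The coefficients select a single position, as [x] may occur several times in [s]. *)
exists (fun i => (i == index x s)%:R); split=> [i|].
  by case: eqP => _; [apply: subring1 | apply: subring0].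
rewrite (bigD1 (Ordinal hi)) //= eqxx mul1r nth_index // big1 ?addr0 // => j.
by rewrite -val_eqE /= => /negbTE ->; rewrite mul0r.
Qed.

Lemma span_sub T E s : submod T E -> (forall x, x \in s -> E x) ->
  span T s `<=` E.
Proof.
move=> hE hs _ [c [hc ->]]; apply: (submod_sum (f := fun i => c i * s`_i) hE) => i hi.
by case: hE => _ [_]; apply=> //; apply/hs/mem_nth.
Qed.

Lemma sub_span T s t : subring T -> {subset s <= t} -> span T s `<=` span T t.
Proof.
move=> hT st; apply: span_sub; first exact: submod_span.
by move=> x /st; apply: mem_span.
Qed.

Lemma nzmod_span T s x : subring T -> x \in s -> x != 0 -> nzmod T (span T s).
Proof.
move=> hT xs x0; split; first exact: submod_span.
by exists x; split=> //; apply: mem_span.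
Qed.

Lemma nzmod_span_neq0 T s : nzmod T (span T s) -> exists2 x, x \in s & x != 0.
Proof.
move=> [_ [_ [[c [_ ->]] h]]]; apply: contrapT => hn; move/eqP: h; apply.
apply: big1 => i _; have [->|n0] := eqVneq s`_i 0; first by rewrite mulr0.
by case: hn; exists s`_i => //; apply: mem_nth.
Qed.

End Submodules.

(** * Semistar operations, GV lists and quasi-maximal ideals *)

Section Semistar.
Variables (K : fieldType).
Implicit Types (D T R V E F I J P Q S : set K) (star : set K -> set K).
Implicit Types (s t : seq K) (x y : K).

Lemma star_nz D star E : semistar D star -> nzmod D E -> nzmod D (star E).
Proof. by case=> h _; apply: h. Qed.

Lemma star_scale D star E x : semistar D star -> x != 0 -> nzmod D E ->
  star (scale x E) = scale x (star E).
Proof. by case=> _ [h _]; apply: h. Qed.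

Lemma star_mono D star E F : semistar D star -> nzmod D E -> nzmod D F ->
  E `<=` F -> star E `<=` star F.
Proof. by case=> _ [_ [h _]]; apply: h. Qed.

Lemma star_ext D star E : semistar D star -> nzmod D E -> E `<=` star E.
Proof. by case=> _ [_ [_ [h _]]]; apply: h. Qed.

Lemma star_idem D star E : semistar D star -> nzmod D E -> star (star E) = star E.
Proof. by case=> _ [_ [_ [_ h]]]; apply: h. Qed.

Lemma star_closure_sub D star E F : semistar D star -> nzmod D E -> nzmod D F ->
  E `<=` star F -> star E `<=` star F.
Proof.
move=> hs hE hF EF; rewrite -(star_idem hs hF).
by apply: (star_mono hs) => //; apply: star_nz.
Qed.

Lemma starfP D star E x : subring D -> submod D E ->
  starf D star E x <-> exists s, [/\ forall y, y \in s -> E y,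
    nzmod D (span D s) & star (span D s) x].
Proof.
move=> hD hE; split=> [[_ [[s ->] [hF [FE hx]]]]|[s [sE hF hx]]].
  by exists s; split=> // y ys; apply/FE/mem_span.
exists (span D s); split; first by exists s.
by do 2!split=> //; apply: span_sub.
Qed.

(* Finite generating sets of the ideals [J] of [D] with [J^star = D^star], a
   semistar analogue of Glaz-Vasconcelos ideals. *)
Definition gv D star s :=
  [/\ forall x, x \in s -> D x, nzmod D (span D s) & star (span D s) = star D].

Definition gvfree D star I := forall s, gv D star s -> exists2 y, y \in s & ~ I y.

(** The closure of the span is a [D]-module, so once it contains 1 it contains [D], and by
    idempotence [star D]. Being GV thus reduces to one membership. *)
Lemma gv_one D star s : subring D -> semistar D star ->
  (forall x, x \in s -> D x) -> nzmod D (span D s) -> star (span D s) 1 ->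
  gv D star s.
Proof.
move=> hD hs sD hF h1; split=> //; apply/seteqP; split.
  by apply: (star_mono hs) => //; [apply: nzmod_self | apply: span_sub => //; apply: submod_self].
apply: (star_closure_sub hs) => //; first exact: nzmod_self.
move=> d dD; rewrite -[d]mulr1; have [[_ [_ hM]] _] := star_nz hs hF.
exact: hM.
Qed.

Lemma gv_has_one D star s : subring D -> semistar D star -> gv D star s ->
  star (span D s) 1.
Proof.
move=> hD hs [_ _ ->]; apply: (star_ext hs); [exact: nzmod_self | exact: subring1].
Qed.

(** For nonzero [u] in [s], scaling 1 in the closure of [t] by [u] puts [u] in the closure of the
    products. That closure therefore contains the closure of [s], hence 1. *)
Lemma gv_mul D star s t : subring D -> semistar D star ->
  gv D star s -> gv D star t -> gv D star [seq x * y | x <- s, y <- t].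
Proof.
move=> hD hs gs gt; have [sD snz _] := gs; have [tD tnz _] := gt.
set st := [seq _ | _ <- _, _ <- _].
have [x xs x0] := nzmod_span_neq0 snz; have [y yt y0] := nzmod_span_neq0 tnz.
have stnz : nzmod D (span D st).
  by apply: (nzmod_span (x := x * y)) => //; [apply: allpairs_f | rewrite mulf_neq0].
apply: gv_one => //.
  by move=> _ /allpairsP[[u v] /= [us vt ->]]; apply: subringM; [|apply: sD|apply: tD].
apply: (star_closure_sub hs) (gv_has_one hD hs gs) => //.
apply: span_sub; first by have [] := star_nz hs stnz.
(* Compatibility of [star] with scaling holds for nonzero scalars only. *)
move=> u us; have [->|u0] := eqVneq u 0.
  by have [[]] := star_nz hs stnz.
have unz := nzmod_scale u0 tnz.
apply: (star_mono hs unz stnz); last first.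
  by rewrite (star_scale hs) //; exists 1; [apply: gv_has_one | rewrite mulr1].
suff : span D t `<=` [set v | span D st (u * v)] by move=> h _ [v /h ? <-].
have [h0 [hA hM]] := submod_span st hD.
apply: span_sub => /=; last by move=> v vt; apply: mem_span => //; apply: allpairs_f.
split=> /=; first by rewrite mulr0.
split=> [a b ha hb|d a hd ha] /=; first by rewrite mulrDr; apply: hA.
by rewrite mulrCA; apply: hM.
Qed.

Lemma gv_unit D star : subring D -> semistar D star -> gv D star [:: 1].
Proof.
move=> hD hs; have h : nzmod D (span D [:: 1]).
  by apply: (nzmod_span (x := 1)); rewrite ?mem_head ?oner_neq0.
apply: gv_one => //.
  by move=> x; rewrite inE => /eqP ->; apply: subring1.
by apply: (star_ext hs) => //; apply: mem_span; rewrite ?mem_head.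
Qed.

(** A GV list inside [I] would put 1 into the [starf]-closure of [I], whose trace on [D] is [I]. *)
Lemma quasi_ideal_gvfree D star I : subring D -> semistar D star ->
  quasi_ideal D (starf D star) I -> proper I -> gvfree D star I.
Proof.
move=> hD hs [[ID hI] [_ Iq]] pI s gs; apply: contrapT => hn; apply: pI.
rewrite -Iq; split; last exact: subring1.
apply/starfP => //; exists s; split; [|by case: gs|exact: gv_has_one].
by move=> y ys; apply: contrapT => hy; apply: hn; exists y.
Qed.

(** Zorn applies because GV lists are finite: one lying in the union of a chain already lies in a
    member of the chain. *)
Lemma exists_max_gvfree D star I : subring D -> semistar D star ->
  ideal D I -> gvfree D star I ->
  exists Q, [/\ I `<=` Q, ideal D Q, gvfree D star Q &
    forall J, ideal D J -> gvfree D star J -> Q `<=` J -> J = Q].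
Proof.
move=> hD hs hI fI.
pose ok A := [/\ I `<=` A, ideal D A & gvfree D star A].
have [C Cok Ctot|Q [hQ Qmax]] := @Zorn_bigcup K (fun A => A = set0 \/ ok A).
  have [[A [CA Aok]]|Cn] := pselect (exists A, C A /\ ok A); last first.
    left; apply/seteqP; split=> // x [A CA Ax]; case: (Cok A CA) => [A0|Aok].
      by rewrite A0 in Ax.
    by case: Cn; exists A.
  have okP B x : C B -> B x -> ok B by move=> /Cok[->|].
  right; split.
  - by move=> x Ix; exists A => //; have [h _ _] := Aok; apply: h.
  - split; first by move=> x [B CB Bx]; have [_ [h _] _] := okP _ _ CB Bx; apply: h.
    split; first by exists A => //; have [_ [_ []]] := Aok.
    split=> [x y [B CB Bx] [B' CB' By]|d x dD [B CB Bx]].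
      have [_ [_ [_ [h _]]] _] := okP _ _ CB Bx.
      have [_ [_ [_ [h' _]]] _] := okP _ _ CB' By.
      by have [BB|BB] := Ctot _ _ CB CB'; [exists B' => //; apply: h'; first apply: BB
        | exists B => //; apply: h; last apply: BB].
    by exists B => //; have [_ [_ [_ [_ h]]] _] := okP _ _ CB Bx; apply: h.
  - move=> s gs; apply: contrapT => hn.
    (* Induction over sublists of [s] finds one member of the chain containing all of [s]. *)
    have /(_ s (fun _ => id)) [B [CB [Bok hB]]] : forall u : seq K, {subset u <= s} ->
        exists B, C B /\ ok B /\ forall y, y \in u -> B y.
      elim=> [_|y u IH us]; first by exists A.
      have [|B [CB [Bok hB]]] := IH; first by move=> z zu; apply: us; rewrite inE zu orbT.
      have [B' CB' By] : (\bigcup_(X in C) X) y.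
        by apply: contrapT => hy; apply: hn; exists y => //; apply/us/mem_head.
      have B'ok := okP _ _ CB' By.
      by have [BB|BB] := Ctot _ _ CB CB'; [exists B'|exists B]; (do 2!split=> //);
        move=> z; rewrite inE => /predU1P[->|/hB] //; apply: BB.
    by have [_ _ /(_ s gs) [y /hB By]] := Bok; apply.
have [Q0|[IQ iQ fQ]] := hQ.
  exfalso; apply: (Qmax I); last by right; split.
  rewrite Q0 properEneq; split=> //; apply/eqP => I0.
  by have [_ [h _]] := hI; rewrite -I0 in h.
exists Q; split=> // J iJ fJ QJ; apply: contrapT => JQ.
apply: (Qmax J); last by right; split=> //; apply: subset_trans QJ.
by rewrite properEneq; split=> //; apply/eqP => QJ'; apply: JQ.
Qed.

(** If [a] and [b] are outside [Q], maximality gives GV lists in [Q + D a] and [Q + D b]. Their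
    product list is GV and lies in [Q + D a b], which is [Q] when [a * b] is in [Q]. *)
Lemma max_gvfree_prime D star Q : subring D -> semistar D star ->
  ideal D Q -> gvfree D star Q ->
  (forall J, ideal D J -> gvfree D star J -> Q `<=` J -> J = Q) ->
  forall a b, D a -> D b -> Q (a * b) -> Q a \/ Q b.
Proof.
move=> hD hs [QD [Q0 [QA QM]]] fQ Qmax a b aD bD Qab.
pose add c := [set x | exists q d, [/\ Q q, D d & x = q + d * c]].
have key c : D c -> ~ Q c -> exists s, gv D star s /\ forall y, y \in s -> add c y.
  move=> cD Qc; apply: contrapT => hn; apply: Qc; rewrite -(Qmax (add c)).
  - by exists 0, 1; split; rewrite ?add0r ?mul1r //; apply: subring1.
  - split; first by move=> _ [q [d [Qq dD ->]]]; apply: subringD; [|apply: QD|apply: subringM].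
    split; first by exists 0, 0; split; rewrite ?add0r ?mul0r //; apply: subring0.
    split=> [_ _ [q [d [Qq dD ->]]] [q' [d' [Qq' dD' ->]]]|t _ tD [q [d [Qq dD ->]]]].
      by exists (q + q'), (d + d'); split; [apply: QA|apply: subringD|ring].
    by exists (t * q), (t * d); split; [apply: QM|apply: subringM|ring].
  - move=> s gs; apply: contrapT => hs'; apply: hn; exists s; split=> // y ys.
    by apply: contrapT => hy; apply: hs'; exists y.
  - by move=> q Qq; exists q, 0; split; rewrite ?mul0r ?addr0 //; apply: subring0.
have [Qa|Qa] := pselect (Q a); first by left.
have [Qb|Qb] := pselect (Q b); first by right.
have [s [gs sa]] := key a aD Qa; have [t [gt tb]] := key b bD Qb.
have [y] := fQ _ (gv_mul hD hs gs gt); case/allpairsP=> [[u v] /= [us vt ->]] []{y}.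
have [q [d [Qq dD ->]]] := sa _ us; have [q' [d' [Qq' dD' ->]]] := tb _ vt.
have -> : (q + d * a) * (q' + d' * b) = (q' + d' * b) * q + (d * a) * q' + (d * d') * (a * b) by ring.
apply: (QA); first apply: QA; apply: QM => //; last exact: subringM.
  by apply: subringD; [|apply: QD|apply: subringM].
exact: subringM.
Qed.

(** The trace on [D] of the [starf]-closure of [Q] is again a GV-free ideal, so it equals [Q] by
    maximality. Larger proper quasi-ideals are GV-free as well, hence equal to [Q]. *)
Lemma max_gvfree_quasi_max D star Q : subring D -> semistar D star ->
  ideal D Q -> (exists x, Q x /\ x != 0) -> gvfree D star Q ->
  (forall J, ideal D J -> gvfree D star J -> Q `<=` J -> J = Q) ->
  quasi_max D (starf D star) Q.
Proof.
move=> hD hs iQ [q [Qq q0]] fQ Qmax; have [QD mQ] := iQ.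
have nzq t : q \in t -> nzmod D (span D t) by move=> /nzmod_span; apply.
have QQ' : Q `<=` starf D star Q `&` D.
  move=> x Qx; split; last exact: QD.
  (* The entry [q] keeps the span nonzero when [x] is 0. *)
  apply/starfP => //; exists [:: q; x]; split.
  - by move=> y; rewrite !inE => /orP[] /eqP ->.
  - by apply: nzq; rewrite mem_head.
  - apply: (star_ext hs); first by apply: nzq; rewrite mem_head.
    by apply: mem_span => //; rewrite !inE eqxx orbT.
(* Finite type: finitely many elements of the [starf]-closure lie in the closure of one finitely
   generated submodule of [Q]. *)
have merge s : (forall y, y \in s -> starf D star Q y) ->
    exists t, [/\ forall y, y \in t -> Q y, nzmod D (span D t) &
      forall y, y \in s -> star (span D t) y].
  elim: s => [_|y s IH hys].
    exists [:: q]; split=> //; first by move=> y; rewrite inE => /eqP ->.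
    by apply: nzq; rewrite mem_head.
  have [|t [tQ tnz ht]] := IH; first by move=> z zs; apply: hys; rewrite inE zs orbT.
  have /starfP [//|//|u [uQ unz hu]] := hys y (mem_head _ _).
  have [x xt x0] := nzmod_span_neq0 tnz.
  have wnz : nzmod D (span D (t ++ u)).
    by apply: (nzmod_span (x := x)) => //; rewrite mem_cat xt.
  exists (t ++ u); split=> //.
    by move=> z; rewrite mem_cat => /orP[/tQ|/uQ].
  move=> z; rewrite inE => /predU1P[->|/ht].
    by apply: (star_mono hs unz wnz) hu; apply: sub_span => // w wu; rewrite mem_cat wu orbT.
  by apply: (star_mono hs tnz wnz); apply: sub_span => // w wt; rewrite mem_cat wt.
have eqQ : starf D star Q `&` D = Q.
  apply: Qmax => //.
    split; first by move=> x [].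
    split; first by apply: QQ'; case: mQ.
    split=> [x y [hx xD] [hy yD]|d x dD [hx xD]]; (split; last by [apply: subringD|apply: subringM]).
      have [|t [tQ tnz ht]] := merge [:: x; y].
        by move=> z; rewrite !inE => /orP[] /eqP ->.
      apply/starfP => //; exists t; split=> //.
      have [[_ [hA _]] _] := star_nz hs tnz.
      by apply: hA; apply: ht; rewrite !inE eqxx ?orbT.
    have /starfP [//|//|u [uQ unz hu]] := hx.
    apply/starfP => //; exists u; split=> //.
    by have [[_ [_ hM]] _] := star_nz hs unz; apply: hM.
  move=> s gs; apply: contrapT => hn.
  have [|t [tQ tnz ht]] := merge s.
    by move=> y ys; apply: contrapT => hy; apply: hn; exists y => // -[].
  (* A GV list in the closure of [Q] makes the list [t] inside [Q] GV, which is impossible. *)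
  have [|y /tQ //] := fQ t; apply: gv_one => //.
    by move=> y /tQ/QD.
  have [sD snz _] := gs.
  apply: (star_closure_sub hs snz tnz) (gv_has_one hD hs gs).
  by apply: span_sub => //; have [] := star_nz hs tnz.
have pQ : proper Q.
  by move=> Q1; have [y] := fQ _ (gv_unit hD hs); rewrite inE => /eqP ->.
split; first by split=> //; split=> //; exists q.
split=> // J Jq pJ QJ; apply: Qmax => //; first by case: Jq.
exact: quasi_ideal_gvfree.
Qed.

Lemma exists_quasi_max D star I : subring D -> semistar D star ->
  ideal D I -> (exists x, I x /\ x != 0) -> gvfree D star I ->
  exists2 Q, quasi_max D (starf D star) Q & I `<=` Q.
Proof.
move=> hD hs iI [x [Ix x0]] fI.
have [Q [IQ iQ fQ Qmax]] := exists_max_gvfree hD hs iI fI.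
by exists Q => //; apply: max_gvfree_quasi_max => //; exists x; split=> //; apply: IQ.
Qed.

(** Enlarge [Q] to an ideal maximal among the GV-free ones. That ideal is prime and a proper
    quasi-ideal, so by maximality of [Q] it is [Q]. *)
Lemma quasi_max_prime D star Q : subring D -> semistar D star ->
  quasi_max D (starf D star) Q -> quasi_prime D (starf D star) Q.
Proof.
move=> hD hs [qQ [pQ Qmax]]; split=> //; split=> //.
have [iQ [[x [Qx x0]] _]] := qQ.
have [Q' [QQ' iQ' fQ' Q'max]] := exists_max_gvfree hD hs iQ (quasi_ideal_gvfree hD hs qQ pQ).
have /= [qQ' [pQ' _]] : quasi_max D (starf D star) Q'.
  by apply: max_gvfree_quasi_max => //; exists x; split=> //; apply: QQ'.
rewrite -(Qmax _ qQ' pQ' QQ').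
exact: (max_gvfree_prime hD hs).
Qed.

Lemma quasi_prime_gvfree D star P : subring D -> semistar D star ->
  quasi_prime D (starf D star) P -> gvfree D star P.
Proof. by move=> hD hs [qP [pP _]]; apply: quasi_ideal_gvfree. Qed.

(** Some entry [y] of [s] avoids [P] and serves as denominator of [x = (x * y) / y]. *)
Lemma locP_gvfree D star E P x s : ideal D P -> gvfree D star P -> gv D star s ->
  (forall y, y \in s -> E (x * y)) -> loc E (D `\` P) x.
Proof.
move=> [_ [P0 _]] fP gs hx; have [y ys Py] := fP s gs.
have y0 : y != 0 by apply/eqP => y0; apply: Py; rewrite y0.
exists (x * y), y; split; first exact: hx.
by split; [split=> //; case: gs => h _ _; apply: h | split=> //; rewrite mulfK].
Qed.

(** The ideal of all [d] in [D] with [x * d] in [E] contains, for each quasi-maximal [Q], a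
    denominator of [x] outside [Q]. It lies in no such [Q], so it contains a GV list. *)
Lemma gv_of_loc D star E x : subring D -> quotfield D -> semistar D star ->
  nzmod D E -> (forall Q, quasi_max D (starf D star) Q -> loc E (D `\` Q) x) ->
  exists2 s, gv D star s & forall y, y \in s -> E (x * y).
Proof.
move=> hD hK hs [[E0 [EA EM]] [e [Ee e0]]] hx.
pose I := [set d | D d /\ E (x * d)].
apply: contrapT => hn.
have [| | |Q Qm IQ] := @exists_quasi_max D star I hD hs.
- split; first by move=> d [].
  split; first by split; [apply: subring0 | rewrite mulr0].
  split=> [a b [aD ha] [bD hb]|d a dD [aD ha]].
    by split; [apply: subringD | rewrite mulrDr; apply: EA].
  by split; [apply: subringM | rewrite mulrCA; apply: EM].
(* The ideal is nonzero: if [x / e = a / b], then [x * b = a * e] lies in [E]. *)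
- have [a [b [aD [bD [b0 xe]]]]] := hK (x / e).
  exists b; split=> //; split=> //.
  by rewrite -[x](divfK e0) xe mulrAC divfK //; apply: EM.
- move=> s gs; apply: contrapT => hs'; apply: hn; exists s => // y ys.
  by apply: contrapT => hy; apply: hs'; exists y => // -[].
have [a [s [Ea [[sD Qs] [s0 xa]]]]] := hx Q Qm.
by apply/Qs/IQ; split=> //; rewrite xa divfK.
Qed.

Lemma stildeP D star E x : subring D -> quotfield D -> semistar D star ->
  nzmod D E -> stilde D star E x <->
  exists2 s, gv D star s & forall y, y \in s -> E (x * y).
Proof.
move=> hD hK hs hE; split=> [|[s gs hx] Q Qm]; first exact: gv_of_loc.
have qp := quasi_max_prime hD hs Qm.
apply: locP_gvfree gs hx; last exact: quasi_prime_gvfree.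
by case: qp => -[].
Qed.

Lemma lstarP D star E x : subring D -> quotfield D -> semistar D star ->
  nzmod D E -> lstar D star E E x <->
  exists2 s, gv D star s & forall y, y \in s -> E (x * y).
Proof.
move=> hD hK hs hE; split=> [hx|[s gs hx] P Pp].
  by apply: gv_of_loc => // Q Qm; apply/hx/quasi_max_prime.
apply: locP_gvfree gs hx; last exact: quasi_prime_gvfree.
by case: Pp => -[].
Qed.

End Semistar.

(** * Localizations at prime ideals and integral closedness *)

Section Localization.
Variable K : fieldType.
Implicit Types (D T R V E F I J P Q S : set K) (star : set K -> set K).
Implicit Types (s t : seq K) (x y : K).

Definition prime_ideal T P :=
  [/\ ideal T P, proper P & forall a b, T a -> T b -> P (a * b) -> P a \/ P b].

Lemma quasi_prime_ideal T star P : quasi_prime T star P -> prime_ideal T P.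
Proof. by move=> [[iP _] [pP h]]. Qed.

Lemma prime_compl1 T P : subring T -> prime_ideal T P -> (T `\` P) 1.
Proof. by move=> hT [_ pP _]; split=> //; apply: subring1. Qed.

Lemma prime_complM T P x y : subring T -> prime_ideal T P ->
  (T `\` P) x -> (T `\` P) y -> (T `\` P) (x * y).
Proof.
move=> hT [_ _ h] [Tx Px] [Ty Py]; split; first exact: subringM.
by move=> /(h _ _ Tx Ty) [].
Qed.

Lemma prime_compl_neq0 T P x : prime_ideal T P -> ~ P x -> x != 0.
Proof. by move=> [[_ [P0 _]] _ _] Px; apply/eqP => x0; apply: Px; rewrite x0. Qed.

Lemma sub_loc E S : S 1 -> E `<=` loc E S.
Proof. by move=> S1 x Ex; exists x, 1; rewrite oner_neq0 divr1. Qed.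

Lemma subring_loc T S : subring T -> S `<=` T -> S 1 ->
  (forall x y, S x -> S y -> S (x * y)) -> subring (loc T S).
Proof.
move=> hT ST S1 SM; have TL := sub_loc (E := T) S1.
split; first by apply: TL; apply: subring0.
split; first by apply: TL; apply: subring1.
split=> _ _ [a [s [Ta [Ss [s0 ->]]]]] [b [t [Tb [St [t0 ->]]]]].
  exists (a * t - b * s), (s * t); split.
    by apply: subringB => //; apply: subringM => //; apply: ST.
  split; first exact: SM.
  split; first by rewrite mulf_neq0.
  by field; rewrite s0 t0.
exists (a * b), (s * t); split; first exact: subringM.
split; first exact: SM.
split; first by rewrite mulf_neq0.
by field; rewrite s0 t0.
Qed.

Lemma subring_loc_prime T P : subring T -> prime_ideal T P ->
  subring (loc T (T `\` P)).
Proof.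
move=> hT hP; apply: subring_loc => //; first exact: prime_compl1.
by move=> x y; apply: prime_complM.
Qed.

Lemma loc_inv T P x : subring T -> prime_ideal T P -> T x -> ~ P x ->
  loc T (T `\` P) x^-1.
Proof.
move=> hT hP Tx Px; exists 1, x; split; first exact: subring1.
by split=> //; split; [apply: prime_compl_neq0 hP Px | rewrite mul1r].
Qed.

Lemma loc_common_denom T P n (c : nat -> K) : subring T -> prime_ideal T P ->
  (forall i, (i < n)%N -> loc T (T `\` P) (c i)) ->
  exists2 d, (T `\` P) d & forall i, (i < n)%N -> T (d * c i).
Proof.
move=> hT hP; elim: n => [_|n IH hc]; first by exists 1 => //; apply: prime_compl1.
have [|d Pd hd] := IH; first by move=> i hi; apply/hc/ltnW.
have [a [s [Ta [Ps [s0 cn]]]]] := hc n (ltnSn n).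
exists (s * d); first exact: prime_complM.
move=> i; rewrite ltnS leq_eqVlt => /predU1P[->|/hd hi].
  have -> : s * d * c n = d * a by rewrite cn; field.
  by apply: subringM => //; case: Pd.
by rewrite -mulrA; apply: subringM => //; case: Ps.
Qed.

Lemma integral_sub R V x : R `<=` V -> integral R x -> integral V x.
Proof. by move=> RV [n [c [hc e]]]; exists n, c; split=> // i /hc/RV. Qed.

(** Such an [x] is a root of the monic polynomial [X^2 - x^2]. *)
Lemma integrally_closed_seminormal R : subring R -> integrally_closed R ->
  seminormal R.
Proof.
move=> hR hc x x2 _; apply: hc; exists 2, (fun i => if i == 0 then - x ^+ 2 else 0).
split=> [[|i] _ /=|]; [exact: subringN | exact: subring0 |].
by rewrite big_ord_recl big_ord1 /= mul0r expr0 mulr1 addr0 subrr.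
Qed.

(* Clearing denominators: if [d c_i] lies in [R], then [d x] is a root of the
   monic polynomial with coefficients [c_i d^(n-i)]. *)
Lemma integrally_closed_loc T R P : subring T -> prime_ideal T P ->
  T `<=` R -> R `<=` loc T (T `\` P) -> integrally_closed R ->
  integrally_closed (loc T (T `\` P)).
Proof.
move=> hT hP TR RL hR x [n [c [hc e]]].
have [d [Td Pd] hd] := loc_common_denom hT hP hc.
have d0 := prime_compl_neq0 hP Pd.
have : integral R (d * x).
  exists n, (fun i => c i * d ^+ (n - i)); split=> [i hi|].
    apply: TR; rewrite -(subnSK hi) exprS mulrA (mulrC (c i)).
    by apply: subringM; [|exact: hd|exact: subringX].
  rewrite -[RHS](mulr0 (d ^+ n)) -[X in _ = _ * X]e mulrDr mulr_sumr exprMn; congr (_ + _).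
  apply: eq_bigr => i _; rewrite exprMn.
  have -> : d ^+ n = d ^+ (n - i) * d ^+ i by rewrite -exprD subnK // ltnW.
  by ring.
move/hR/RL => h; rewrite -[x](mulKf d0); apply: subringM => //.
  exact: subring_loc_prime.
exact: loc_inv.
Qed.

Definition unit_in V x := [/\ V x, x != 0 & V x^-1].

(** Locality phrased without a maximal ideal: sums of nonunits are nonunits. *)
Definition local_ring V := forall a b, V a -> V b -> unit_in V (a + b) ->
  unit_in V a \/ unit_in V b.

(** As [0^-1 = 0], the case [x = 0] only asks that [V] contain 0. *)
Definition valuation_ring V := forall x, V x \/ V x^-1.

(** If both numerators were in [P], clearing denominators in [(a / s + b / t) * (c / u) = 1] would
    put [s * t * u] in [P], although each factor is outside it. *)
Lemma loc_prime_local T P : subring T -> prime_ideal T P ->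
  local_ring (loc T (T `\` P)).
Proof.
move=> hT hP _ _ [a [s [Ta [Ps [s0 ->]]]]] [b [t [Tb [Pt [t0 ->]]]]].
move=> [_ ab0 [c [u [Tc [Pu [u0 e]]]]]].
have unitP z w : T z -> (T `\` P) w -> ~ P z -> unit_in (loc T (T `\` P)) (z / w).
  move=> Tz Pw Pz; have w0 := prime_compl_neq0 hP (proj2 Pw).
  have z0 := prime_compl_neq0 hP Pz.
  split; [by exists z, w | by rewrite mulf_neq0 ?invr_eq0 |].
  by exists w, z; rewrite invf_div; case: Pw.
have [Pa|Pa] := pselect (P a); last by left; apply: unitP.
have [Pb|Pb] := pselect (P b); last by right; apply: unitP.
have [_ []] := prime_complM hT hP (prime_complM hT hP Ps Pt) Pu.
have -> : s * t * u = (c * t) * a + (c * s) * b.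
  have : (a / s + b / t) * (c / u) = 1 by rewrite -e mulfV.
  move/(congr1 (fun z => z * (s * t * u))); rewrite mul1r => <-.
  by field; rewrite s0 t0 u0.
have [[_ [_ [PA PM]]] _ _] := hP.
by apply: PA; apply: PM => //; apply: subringM => //; [case: Pt|case: Ps].
Qed.

(** If only [x^-1] is known to be in [V], dividing the monic equation of degree [n.+1] by [x ^+ n]
    writes [x] as a polynomial in [x^-1]. In degree 0 the equation would read [1 = 0]. *)
Lemma valuation_integrally_closed V : subring V -> valuation_ring V ->
  integrally_closed V.
Proof.
move=> hV vV x [[|n] [c [hc e]]].
  by move/eqP: e; rewrite expr0 big_ord0 addr0 oner_eq0.
have [//|Vx] := vV x; have [->|x0] := eqVneq x 0; first exact: subring0.
have -> : x = - \sum_(i < n.+1) c i * x^-1 ^+ (n - i).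
  apply/eqP; rewrite -addr_eq0 -(mulrI_eq0 _ (mulfI (expf_neq0 n x0))).
  rewrite mulrDr -exprSr -[X in _ == X]e mulr_sumr; apply/eqP; congr (_ + _).
  apply: eq_bigr => i _; rewrite mulrCA; congr (_ * _).
  by rewrite -{1}(subnKC (leq_ord i)) exprD -mulrA -exprMn divff // expr1n mulr1.
apply: subringN => //.
apply: (subring_sum (f := fun i => c i * x^-1 ^+ (n - i))) => // i hi.
by apply: subringM; [|apply: hc|apply: subringX].
Qed.

(* Descent on the degree: the leading term [a x^(n+1)] has [a x] in [V], so it
   can be merged into the term of degree [n] unless [a] or [a x] is a unit. *)
Lemma local_unit_coef_root V n (c : nat -> K) x : subring V ->
  integrally_closed V -> local_ring V -> (forall i, V (c i)) ->
  \sum_(i < n.+1) c i * x ^+ i = 0 ->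
  (exists2 i, (i <= n)%N & unit_in V (c i)) -> V x \/ V x^-1.
Proof.
move=> hV iV lV; elim: n c => [|n IH] c hc e [i hi ui].
  move: hi ui e; rewrite leqn0 => /eqP -> [_ c0 _].
  by rewrite big_ord1 expr0 mulr1 => /eqP; rewrite (negbTE c0).
pose a := c n.+1; have Va : V a by apply: hc.
(* Multiplied by [a ^+ n], the equation becomes monic in [a * x]. *)
have Vb : V (a * x).
  apply: iV; exists n.+1, (fun j => c j * a ^+ (n - j)); split=> [j _|].
    by apply: subringM => //; apply: subringX.
  rewrite -[RHS](mulr0 (a ^+ n)) -[X in _ = _ * X]e [in RHS]big_ord_recr /= mulrDr addrC mulr_sumr.
  congr (_ + _); last by rewrite -/a exprMn exprSr; ring.
  apply: eq_bigr => j _; rewrite exprMn.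
  have -> : a ^+ n = a ^+ (n - j) * a ^+ j by rewrite -exprD subnK ?leq_ord.
  by ring.
have [[_ a0 Va']|na] := pselect (unit_in V a).
  by left; rewrite -[x](mulKf a0); apply: subringM.
have [[_ b0 Vb']|nb] := pselect (unit_in V (a * x)).
  right; move: b0; rewrite mulf_eq0 negb_or => /andP[a0 x0].
  have -> : x^-1 = a * (a * x)^-1 by field; rewrite a0 x0.
  exact: subringM.
apply: (IH (fun j => if j == n then c n + a * x else c j)).
- by move=> j /=; case: eqP => _ //; apply: subringD.
- rewrite -[RHS]e big_ord_recr /= eqxx [in RHS]big_ord_recr [in RHS]big_ord_recr /=.
  rewrite mulrDl addrA -/a exprS mulrA; congr (_ + _ + _).
  by apply: eq_bigr => j _; rewrite ltn_eqF.
move: hi; rewrite leq_eqVlt ltnS => /predU1P[ein|hi]; first by rewrite ein in ui.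
exists i => //=; case: eqP => [ein|//]; rewrite ein in ui.
(* If the unit was [c n] itself, locality passes it to the merged coefficient, because [a * x] is
   not a unit. *)
have : unit_in V (c n + a * x + - (a * x)) by rewrite addrK.
move=> /lV [||//|[_ b0 Vb']]; [exact: subringD|exact: subringN|].
case: nb; split=> //; first by rewrite -oppr_eq0.
by rewrite -[_^-1]opprK -invrN; apply: subringN.
Qed.

(* [R[x^2, x^3]] consists of the values at [x] of polynomials without linear term. *)
Definition cusp_ring R x : set K :=
  [set y | exists p : {poly K}, [/\ forall i, R p`_i, p`_1 = 0 & y = p.[x]]].

Lemma subring_cusp R x : subring R -> subring (cusp_ring R x).
Proof.
move=> hR; have h0 := subring0 hR; have h1 := subring1 hR.
split; first by exists 0; split=> [i||]; rewrite ?coef0 ?horner0.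
split; first by exists 1; split=> [i||]; rewrite ?coef1 ?hornerC //; case: (i == 0)%N.
split=> _ _ [p [hp p1 ->]] [q [hq q1 ->]].
  exists (p - q); split=> [i||]; rewrite ?coefB ?hornerE //; first exact: subringB.
  by rewrite p1 q1 subrr.
exists (p * q); split=> [i||]; rewrite ?hornerM // coefM.
  apply: (subring_sum (f := fun j => p`_j * q`_(i - j))) => // j _.
  exact: subringM.
by rewrite big_ord_recl big_ord1 /= q1 p1 mulr0 mul0r addr0.
Qed.

Lemma sub_cusp R x : subring R -> R `<=` cusp_ring R x.
Proof.
move=> hR y Ry; exists y%:P; split=> [i||]; rewrite ?coefC ?hornerC //.
by case: (i == 0)%N => //; apply: subring0.
Qed.

Lemma cusp_ring_pow R x n : subring R -> (1 < n)%N -> cusp_ring R x (x ^+ n).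
Proof.
move=> hR hn; exists 'X^n; split=> [i||]; rewrite ?coefXn ?hornerXn //.
  by case: (i == n); [apply: subring1 | apply: subring0].
by rewrite ltn_eqF.
Qed.

(* If [x] lies in [V[x^2, x^3]], then [x] is a root of a polynomial over [V]
   whose linear coefficient is [-1]. *)
Lemma seminormal_overrings_valuation V : subring V -> integrally_closed V ->
  local_ring V -> (forall T, overring V T -> seminormal T) -> valuation_ring V.
Proof.
move=> hV iV lV sV x.
have oV : overring V (cusp_ring V x).
  by split; [apply: subring_cusp | apply: sub_cusp].
have [p [hp p1 xp]] : cusp_ring V x x.
  by apply: sV => //; apply: cusp_ring_pow.
pose q := p - 'X.
have hq i : V q`_i.
  rewrite coefB coefX; apply: subringB => //.
  by case: (i == 1)%N; [apply: subring1 | apply: subring0].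
have q1 : q`_1 = -1 by rewrite coefB coefX p1 sub0r.
have sq : (1 < size q)%N.
  by rewrite ltnNge; apply/negP => /leq_sizeP/(_ 1%N (leqnn _)) /eqP; rewrite q1 oppr_eq0 oner_eq0.
apply: (local_unit_coef_root (n := (size q).-1) (c := fun i => q`_i)) => //.
  by rewrite prednK ?(ltnW sq) // -horner_coef !hornerE -xp subrr.
exists 1%N; first by rewrite -ltnS prednK // ltnW.
have V1 := subring1 hV; rewrite q1; split; last by rewrite invrN invr1; apply: subringN.
  exact: subringN.
by rewrite oppr_eq0 oner_neq0.
Qed.

(** Divisibility over a valuation ring is total, so a finite list has an entry dividing all the
    others: that entry generates the span over [V]. *)
Lemma valuation_divides_all V s x : subring V -> valuation_ring V -> x \in s -> x != 0 ->
  exists a, [/\ a \in s, a != 0 & forall y, y \in s -> V (y / a)].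
Proof.
move=> hV vV; suff h (u : seq K) : (exists2 z, z \in u & z != 0) ->
    exists a, [/\ a \in u, a != 0 & forall y, y \in u -> V (y / a)].
  by move=> xs x0; apply: h; exists x.
have V1 : V 1 := subring1 hV.
elim: u => [[z]|z u IH hz] //.
(* When the tail has only zero entries, the head is the nonzero one and divides everything. *)
have [[w wu w0]|un] := pselect (exists2 w, w \in u & w != 0); last first.
  have u0 y : y \in u -> y = 0.
    by move=> yu; apply/eqP/negPn/negP => y0; apply: un; exists y.
  have z0 : z != 0.
    by case: hz => w; rewrite inE => /predU1P[->//|/u0 ->]; rewrite eqxx.
  exists z; split=> //; first exact: mem_head.
  move=> y; rewrite inE => /predU1P[->|/u0 ->]; first by rewrite divff.
  by rewrite mul0r; apply: subring0.
have [|a [au a0 ha]] := IH; first by exists w.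
have [za|za] := vV (z / a).
  exists a; split=> //; first by rewrite inE au orbT.
  by move=> y; rewrite inE => /predU1P[->|/ha].
have [z0|z0] := eqVneq z 0.
  exists a; split=> //; first by rewrite inE au orbT.
  by move=> y; rewrite inE => /predU1P[->|/ha //]; rewrite z0 mul0r; apply: subring0.
exists z; split=> //; first exact: mem_head.
move=> y; rewrite inE => /predU1P[->|/ha hy]; first by rewrite divff.
have -> : y / z = (y / a) * (z / a)^-1 by field; rewrite a0 z0.
exact: subringM.
Qed.

End Localization.

(** * Linked overrings and the operations [vop], [top] and [dop] *)

Section Linked.
Variable K : fieldType.
Implicit Types (D T R V E F I J P Q S : set K) (star : set K -> set K).
Implicit Types (s t : seq K) (x y : K).

Lemma quotfield_overring D T : quotfield D -> overring D T -> quotfield T.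
Proof.
move=> hK [_ DT] x; have [a [b [Da [Db h]]]] := hK x.
by exists a, b; split; [apply: DT | split; [apply: DT|]].
Qed.

Lemma submod_colon T E : subring T -> submod T (colon T E).
Proof.
move=> hT; split=> [e _|]; first by rewrite mul0r; apply: subring0.
split=> [x y hx hy e Ee|t x Tt hx e Ee].
  by rewrite mulrDl; apply: subringD; [|apply: hx|apply: hy].
by rewrite -mulrA; apply: subringM => //; apply: hx.
Qed.

Lemma submod_colon_elt T E x : submod T E -> submod T [set y | E (x * y)].
Proof.
move=> [h0 [hA hM]]; split=> /=; first by rewrite mulr0.
split=> [a b ha hb|d a hd ha] /=; first by rewrite mulrDr; apply: hA.
by rewrite mulrCA; apply: hM.
Qed.

Lemma colon_anti T E F : E `<=` F -> colon T F `<=` colon T E.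
Proof. by move=> EF x hx e /EF; apply: hx. Qed.

Lemma sub_vop T E : E `<=` vop T E.
Proof. by move=> e Ee x; rewrite mulrC; apply. Qed.

Lemma semistar_vop T : subring T -> semistar T (vop T).
Proof.
move=> hT; split.
  move=> E [_ [e [Ee e0]]]; split; first exact: submod_colon.
  by exists e; split=> //; apply: sub_vop.
split.
  move=> x E x0 _; apply/seteqP; split=> [z hz|_ [z hz <-] y hy].
    exists (z / x); last by rewrite mulrC divfK.
    move=> w hw; have -> : z / x * w = z * (w / x) by ring.
    by apply: hz => _ [e Ee <-]; rewrite mulrA divfK //; apply: hw.
  have -> : x * z * y = z * (y * x) by ring.
  by apply: hz => e Ee; rewrite -mulrA; apply: hy; exists e.
split; first by move=> E F _ _ EF; do 2!apply: colon_anti.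
split; first by move=> E _; apply: sub_vop.
move=> E _; apply/seteqP; split; last exact: sub_vop.
by apply: colon_anti; apply: sub_vop.
Qed.

(** If [x] multiplies a GV list for [vop T] into [T], then 1 in the double colon forces [1 * x] into
    [T]. Statements on all [stilde T star' T] thereby specialize to [T] itself. *)
Lemma stilde_vop T : subring T -> quotfield T -> stilde T (vop T) T = T.
Proof.
move=> hT hK; have hv := semistar_vop hT.
apply/seteqP; split=> x.
  case/(stildeP x hT hK hv (nzmod_self hT)) => s gs hx.
  rewrite -[x]mul1r; apply: (gv_has_one hT hv gs) => y; move: y.
  exact: (span_sub (submod_colon_elt x (submod_self hT))).
move=> Tx; apply/stildeP => //; first exact: nzmod_self.
exists [:: 1]; first exact: gv_unit.
by move=> y; rewrite inE => /eqP ->; rewrite mulr1.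
Qed.

(** The working form of t-linkedness: it follows from being linked for [top T], yields being linked
    for [vop T], and makes [T] a fixed point of [lstar]. *)
Definition gvclosed D star T :=
  forall s x, gv D star s -> (forall y, y \in s -> T (x * y)) -> T x.

Lemma linked_gv D star T star' s : linked D star T star' -> gv D star s ->
  star' (span T s) = star' T.
Proof. by move=> h [sD [_ nz] e]; apply: h. Qed.

Lemma linked_gvP D star T star' : subring D ->
  (forall s, gv D star s -> star' (span T s) = star' T) <-> linked D star T star'.
Proof.
move=> hD; split=> [h s sD nz e|h s gs]; last exact: linked_gv h gs.
by apply: h; split=> //; split=> //; apply: submod_span.
Qed.

Lemma gv_overring D star T star' s : overring D T -> semistar T star' ->
  linked D star T star' -> gv D star s -> gv T star' s.
Proof.
move=> [hT DT] hs' hl gs; have [sD snz _] := gs.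
have [x xs x0] := nzmod_span_neq0 snz.
split; [by move=> y /sD/DT | exact: nzmod_span xs x0 | exact: linked_gv hl gs].
Qed.

(** For [dop] the extended ideal is [T] itself, so every [star'] takes equal values on the two. *)
Lemma linked_dop D star T star' : linked D star T (@dop K) -> linked D star T star'.
Proof. by move=> h s sD nz e; have := h s sD nz e; rewrite /dop => ->. Qed.

(** Linkedness puts 1 in the v-closure of some [F] inside [span T s]. Since [x] multiplies [F] into
    [T], it multiplies 1 into [T]. *)
Lemma linked_top_gvclosed D star T : overring D T ->
  linked D star T (top T) -> gvclosed D star T.
Proof.
move=> [hT DT] hl s x gs hx.
have : top T T 1.
  exists T; split; first exists [:: 1].
    apply/seteqP; split=> [y Ty|].
      rewrite -[y]mulr1; have [_ [_ hM]] := submod_span [:: 1] hT.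
      by apply: hM => //; apply: mem_span; rewrite ?mem_head.
    apply: span_sub; first exact: submod_self.
    by move=> y; rewrite inE => /eqP ->; apply: subring1.
  split; first exact: nzmod_self.
  by split=> //; apply: sub_vop; apply: subring1.
rewrite -(linked_gv hl gs) => -[F [_ [_ [Fs h1]]]].
rewrite -[x]mul1r; apply: h1 => y /Fs; move: y.
exact: (span_sub (submod_colon_elt x (submod_self hT))).
Qed.

(** Being [gvclosed] makes the inner colons of [span T s] and of [T] agree already. *)
Lemma gvclosed_linked_vop D star T : subring D -> overring D T ->
  gvclosed D star T -> linked D star T (vop T).
Proof.
move=> hD [hT DT] hc; apply/linked_gvP => // s gs; congr colon.
have [sD _ _] := gs.
have sT : span T s `<=` T.
  by apply: span_sub; [apply: submod_self | move=> y /sD/DT].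
apply/seteqP; split; last exact: colon_anti.
move=> x hx; have Tx : T x.
  by apply: (hc s) => // y ys; apply/hx/mem_span.
by move=> y; apply: subringM.
Qed.

Lemma nzmod_overring D T : overring D T -> nzmod D T.
Proof.
move=> [hT DT]; have [h nz] := nzmod_self hT.
by split=> //; apply: submod_weaken h.
Qed.

Lemma lstar_gvclosed_id D star T : subring D -> quotfield D -> semistar D star ->
  overring D T -> gvclosed D star T -> lstar D star T T = T.
Proof.
move=> hD hK hs oT hc; apply/seteqP; split=> x.
  by case/(lstarP x hD hK hs (nzmod_overring oT)) => s; apply: hc.
move=> Tx; apply/lstarP => //; first exact: nzmod_overring.
exists [:: 1]; first exact: gv_unit.
by move=> y; rewrite inE => /eqP ->; rewrite mulr1.
Qed.

Lemma overring_lstar D star T : subring D -> overring D T ->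
  overring D (lstar D star T T).
Proof.
move=> hD [hT DT].
have hL P : quasi_prime D (starf D star) P -> subring (loc T (D `\` P)).
  move=> /quasi_prime_ideal hP; apply: subring_loc => //.
  - by move=> x [/DT].
  - exact: prime_compl1.
  - by move=> x y; apply: prime_complM.
split; last first.
  move=> x Dx P /quasi_prime_ideal hP; apply: sub_loc; last exact: DT.
  exact: prime_compl1.
split; first by move=> P /hL; apply: subring0.
split; first by move=> P /hL; apply: subring1.
split=> x y hx hy P hP; have hLP := hL P hP.
  by apply: subringB; [|apply: hx|apply: hy].
by apply: subringM; [|apply: hx|apply: hy].
Qed.

(** At each [P] some entry [y] of the GV list avoids [P], and [x * y = a / u] gives
    [x = a / (u * y)]. *)
Lemma lstar_gvclosed D star T : subring D -> semistar D star ->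
  gvclosed D star (lstar D star T T).
Proof.
move=> hD hs s x gs hx P hP; have [y ys Py] := quasi_prime_gvfree hD hs hP gs.
have hP' := quasi_prime_ideal hP; have y0 := prime_compl_neq0 hP' Py.
have [a [u [Ta [Pu [u0 e]]]]] := hx y ys P hP.
have [sD _ _] := gs.
exists a, (u * y); split=> //; split.
  by apply: prime_complM => //; split=> //; apply: sD.
split; first by rewrite mulf_neq0.
by rewrite invfM mulrA -e mulfK.
Qed.

Lemma gv_invertible_linked D star V : subring D -> overring D V ->
  (forall s, gv D star s -> exists y, [/\ y \in s, y != 0 & V y^-1]) ->
  linked D star V (@dop K).
Proof.
move=> hD [hV DV] h; apply/linked_gvP => // s gs; have [sD _ _] := gs.
rewrite /dop; apply/seteqP; split.
  by apply: span_sub; [apply: submod_self | move=> y /sD/DV].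
have [y [ys y0 Vy]] := h s gs => x Vx.
have [_ [_ hM]] := submod_span s hV.
by rewrite -[x](divfK y0); apply: hM; [apply: subringM | apply: mem_span].
Qed.

(** GV lists of [D] stay GV in [T], so they have an entry outside [N], which is invertible in the
    localization and hence in [V]. *)
Lemma linked_loc D star T star' N V : subring D -> overring D T ->
  semistar T star' -> linked D star T star' ->
  quasi_max T (starf T star') N -> overring (loc T (T `\` N)) V ->
  linked D star V (@dop K).
Proof.
move=> hD oT hs' hl hN [hV NV]; have [hT DT] := oT.
have qN := quasi_max_prime hT hs' hN; have pN := quasi_prime_ideal qN.
apply: gv_invertible_linked => //.
  split=> // x /DT Tx; apply: NV; apply: sub_loc => //; exact: prime_compl1.
move=> s gs; have gs' := gv_overring oT hs' hl gs.
have [y ys Ny] := quasi_prime_gvfree hT hs' qN gs'.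
exists y; split=> //; first exact: prime_compl_neq0 pN Ny.
by apply: NV; apply: loc_inv => //; have [h _ _] := gs'; apply: h.
Qed.

Lemma stilde_integrally_closed T star :
  (forall N, quasi_max T (starf T star) N -> integrally_closed (loc T (T `\` N))) ->
  integrally_closed (stilde T star T).
Proof.
by move=> h x hx N hN; apply: h => //; apply: integral_sub hx => y; apply.
Qed.

Lemma subring_stilde T star : subring T -> semistar T star ->
  subring (stilde T star T).
Proof.
move=> hT hs.
have hL N : quasi_max T (starf T star) N -> subring (loc T (T `\` N)).
  by move=> /(quasi_max_prime hT hs)/quasi_prime_ideal; apply: subring_loc_prime.
split; first by move=> P /hL; apply: subring0.
split; first by move=> P /hL; apply: subring1.
split=> x y hx hy P hP; have hLP := hL P hP.
  by apply: subringB; [|apply: hx|apply: hy].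
by apply: subringM; [|apply: hx|apply: hy].
Qed.

(** The localizations of [T] at quasi-maximal ideals are d-linked by [linked_loc], and [stilde]
    intersects them. *)
Lemma dlinked_integrally_closed_stilde D star T star' : subring D ->
  (forall V, overring D V -> linked D star V (@dop K) -> integrally_closed V) ->
  overring D T -> semistar T star' -> linked D star T star' ->
  integrally_closed (stilde T star' T).
Proof.
move=> hD h oT hs' hl; have [hT DT] := oT.
apply: stilde_integrally_closed => N hN.
have pN := quasi_prime_ideal (quasi_max_prime hT hs' hN).
have hL := subring_loc_prime hT pN; apply: h.
  split=> // x /DT; apply: sub_loc; exact: prime_compl1.
by apply: (linked_loc hD oT hs' hl hN); split.
Qed.

(** * P-star-MDs and valuation localizations *)

Lemma prodset_colon_sub D F : subring D -> prodset F (colon D F) `<=` D.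
Proof.
move=> hD _ [n [a [b [hab ->]]]].
apply: (subring_sum (f := fun i => a i * b i)) => // i /hab[Fa hb].
by rewrite mulrC; apply: hb.
Qed.

Lemma submod_prodset_colon D F : subring D -> submod D F ->
  submod D (prodset F (colon D F)).
Proof.
move=> hD hF; split; first by exists 0%N, (fun=> 0), (fun=> 0); rewrite big_ord0.
split=> [_ _ [n [a [b [hab ->]]]] [m [a' [b' [hab' ->]]]]|d _ Dd [n [a [b [hab ->]]]]].
  exists (n + m)%N, (fun i => if (i < n)%N then a i else a' (i - n)%N),
    (fun i => if (i < n)%N then b i else b' (i - n)%N); split.
    move=> i hi; case: ltnP => hin; first exact: hab.
    by apply: hab'; rewrite ltn_subLR.
  rewrite big_split_ord /=; congr (_ + _); apply: eq_bigr => i _.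
    by rewrite ltn_ord.
  by rewrite ltnNge leq_addr /= addKn.
exists n, (fun i => d * a i), b; split.
  by move=> i /hab[Fa hb]; split=> //; have [_ [_ hM]] := hF; apply: hM.
by rewrite mulr_sumr; apply: eq_bigr => i _; rewrite mulrA.
Qed.

(** Take [F = D + D x]. The product of [F] and its inverse contains a GV list, which escapes [N], so
    some [b] in the inverse has [b] or [b * x] outside [N]; accordingly [x = (b * x) / b] or
    [x^-1 = b / (b * x)] lies in the localization. *)
Lemma PstarMD_loc_valuation D star T star' N : subring D -> semistar D star ->
  PstarMD D star -> overring D T -> semistar T star' -> linked D star T star' ->
  quasi_max T (starf T star') N -> valuation_ring (loc T (T `\` N)).
Proof.
move=> hD hs hP oT hs' hl hN x; have [hT DT] := oT.
have qN := quasi_max_prime hT hs' hN; have pN := quasi_prime_ideal qN.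
have [[NT mN] _ _] := pN; have [N0 [NA NM]] := mN.
pose F := span D [:: 1; x].
have F1 : F 1 by apply: mem_span; rewrite ?mem_head.
have Fx : F x by apply: mem_span; rewrite // !inE eqxx orbT.
have nzF : nzmod D F by apply: (nzmod_span (x := 1)); rewrite ?mem_head ?oner_neq0.
pose A := prodset F (colon D F).
have AD : A `<=` D := prodset_colon_sub hD.
have mA : submod D A := submod_prodset_colon hD (proj1 nzF).
have /(starfP star 1 hD mA) [s [sA snz s1]] : starf D star A 1.
  rewrite hP //; last by exists [:: 1; x].
  by apply: (star_ext hs); [exact: nzmod_self | exact: subring1].
have gs : gv D star s by apply: gv_one => // y /sA/AD.
have [y ys Ny] := quasi_prime_gvfree hT hs' qN (gv_overring oT hs' hl gs).
have [b [Cb nb]] : exists b, colon D F b /\ ~ (N b /\ N (b * x)).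
  apply: contrapT => hn; apply: Ny; have [n [a [b [hab ->]]]] := sA y ys.
  apply: (submod_sum (f := fun i => a i * b i) mN) => i /hab [Fa hb].
  have [Nb Nbx] : N (b i) /\ N (b i * x).
    by apply: contrapT => hh; apply: hn; exists (b i).
  have mN' := submod_colon_elt (b i) (submod_weaken DT mN).
  rewrite mulrC; apply: (span_sub mN') Fa => z.
  by rewrite !inE => /orP[] /eqP -> //=; rewrite mulr1.
have Db : D b by rewrite -[b]mulr1; apply: Cb.
have Dbx : D (b * x) by apply: Cb.
have [Nb|Nb] := pselect (N b); last first.
  left; exists (b * x), b; split; first exact: DT.
  have b0 := prime_compl_neq0 pN Nb.
  by split; [split=> //; apply: DT | rewrite b0 mulrC mulKf].
have Nbx : ~ N (b * x) by move=> h; apply: nb.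
have := prime_compl_neq0 pN Nbx; rewrite mulf_eq0 negb_or => /andP[b0 x0].
right; exists b, (b * x); split; first exact: DT.
split; first by split=> //; apply: DT.
by split; [rewrite mulf_neq0 | field; rewrite b0 x0].
Qed.

(** Otherwise the product [A] of [F] and its inverse lies in some [Q]. Over the localization an
    entry [a] generates [F]; a common denominator [d] outside [Q] of the quotients by [a] gives
    [d / a] in the inverse, so [d = a * (d / a)] lies in [A], a contradiction. *)
Lemma loc_valuation_PstarMD D star : subring D -> quotfield D -> semistar D star ->
  (forall Q, quasi_max D (starf D star) Q -> valuation_ring (loc D (D `\` Q))) ->
  PstarMD D star.
Proof.
move=> hD hK hs hval F [s eF] nzF; rewrite {F}eF in nzF *; set F := span D s in nzF *.
have AD := @prodset_colon_sub D F hD.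
have mA := submod_prodset_colon hD (proj1 nzF).
set A := prodset F (colon D F) in AD mA *.
have mem_prod a b : F a -> colon D F b -> A (a * b).
  by move=> Fa hb; exists 1%N, (fun=> a), (fun=> b); rewrite big_ord1.
have denom d : (forall i, (i < size s)%N -> D (d * s`_i)) -> colon D F d.
  move=> hd; apply: (span_sub (submod_colon_elt d (submod_self hD))) => y ys /=.
  by rewrite -(nth_index 0 ys); apply: hd; rewrite index_mem.
have [x xs x0] := nzmod_span_neq0 nzF.
have [t gt tA] : exists2 t, gv D star t & forall y, y \in t -> A y.
  apply: contrapT => hn.
  have [| | |Q hQ AQ] := @exists_quasi_max K D star A hD hs.
  - by split.
  (* A nonzero common denominator of the generators gives the nonzero element [x * d] of [A]. *)
  - have [d d0 [Dd hd]] : exists2 d, d != 0 & D d /\ forall i, (i < size s)%N -> D (d * s`_i).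
      elim: (size s) => [|n [d d0 [Dd hd]]].
        by exists 1; [exact: oner_neq0 | split=> //; apply: subring1].
      have [a [b [Da [Db [b0 e]]]]] := hK s`_n.
      exists (b * d); [by rewrite mulf_neq0 | split; first exact: subringM].
      move=> i; rewrite ltnS leq_eqVlt => /predU1P[->|/hd hi].
        have -> : b * d * s`_n = d * a by rewrite e; field.
        exact: subringM.
      by rewrite -mulrA; apply: subringM.
    exists (x * d); split; last by rewrite mulf_neq0.
    by apply: mem_prod; [apply: mem_span | apply: denom].
  - move=> t gt; apply: contrapT => ht; apply: hn; exists t => // y yt.
    by apply: contrapT => hy; apply: ht; exists y.
  have pQ := quasi_prime_ideal (quasi_max_prime hD hs hQ).
  have hL := subring_loc_prime hD pQ.
  have [a [as_ a0 ha]] := valuation_divides_all hL (hval Q hQ) xs x0.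
  have [|d [Dd Qd] hd] := loc_common_denom (n := size s) (c := fun i => s`_i / a) hD pQ.
    by move=> i hi; apply/ha/mem_nth.
  apply/Qd/AQ; rewrite -(divfK a0 d) mulrC; apply: mem_prod; first exact: mem_span.
  by apply: denom => i hi; rewrite mulrAC -mulrA; apply: hd.
have [tD tnz <-] := gt.
apply/seteqP; split=> [z [G [_ [nzG [GA hz]]]]|z hz].
  have [_ _ ->] := gt; apply: (star_mono hs nzG (nzmod_self hD)) hz.
  exact: subset_trans AD.
by apply/starfP => //; exists t.
Qed.

Lemma dlinked_seminormal_loc_valuation D star Q : subring D -> semistar D star ->
  integrally_closed (stilde D star D) ->
  (forall V, overring D V -> linked D star V (@dop K) -> seminormal V) ->
  quasi_max D (starf D star) Q -> valuation_ring (loc D (D `\` Q)).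
Proof.
move=> hD hs hi hsn hQ; have pQ := quasi_prime_ideal (quasi_max_prime hD hs hQ).
have DL : D `<=` loc D (D `\` Q) by apply: sub_loc; apply: prime_compl1.
apply: seminormal_overrings_valuation; first exact: subring_loc_prime.
(* [stilde D star D] lies between [D] and its localization at [Q], so integral closedness passes to
   the latter. *)
- apply: integrally_closed_loc hi => //; last by move=> x; apply.
  move=> x Dx P hP; apply: sub_loc => //; apply: prime_compl1 => //.
  exact: quasi_prime_ideal (quasi_max_prime hD hs hP).
- exact: loc_prime_local.
- move=> V [hV LV]; have oV : overring D V by split=> //; apply: subset_trans LV.
  have oD : overring D D by split.
  by apply: hsn => //; apply: (linked_loc hD oD hs _ hQ).
Qed.

End Linked.

Theorem theorem5p3 (K : fieldType) (D : set K) (hD : subring D) (hK : quotfield D)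
  (star : set K -> set K) (hstar : semistar D star) :
  [<-> (forall (T : set K) (star' : set K -> set K), overring D T -> semistar T star' ->
          linked D star T star' -> integrally_closed (stilde T star' T));
       (forall T : set K, overring D T -> integrally_closed (lstar D star T T));
       (forall T : set K, overring D T -> linked D star T (top T) -> integrally_closed T);
       (forall T : set K, overring D T -> linked D star T (@dop K) -> integrally_closed T);
       integrally_closed (stilde D star D) /\
       (forall (T : set K) (star' : set K -> set K), overring D T -> semistar T star' ->
          linked D star T star' -> seminormal (stilde T star' T));
       integrally_closed (stilde D star D) /\
       (forall T : set K, overring D T -> linked D star T (top T) -> seminormal T);
       integrally_closed (stilde D star D) /\
       (forall T : set K, overring D T -> linked D star T (@dop K) -> seminormal T);
       PstarMD D star].
Proof.
tfae.
(* The hypothesis is applied to the overring [lstar D star T T] with its own v-operation. *)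
- move=> h T oT; have oL := overring_lstar star hD oT.
  rewrite -(stilde_vop (proj1 oL) (quotfield_overring hK oL)).
  apply: h => //; first by apply: semistar_vop; case: oL.
  by apply: gvclosed_linked_vop => //; apply: lstar_gvclosed.
- move=> h T oT hl; rewrite -(lstar_gvclosed_id hD hK hstar oT); first exact: h.
  exact: linked_top_gvclosed.
- by move=> h T oT hl; apply: h => //; apply: linked_dop.
- move=> h; have hi T star' := @dlinked_integrally_closed_stilde K D star T star' hD h.
  split; first by apply: hi => //; split.
  move=> T star' oT hs' hl; apply: integrally_closed_seminormal; last exact: hi.
  by apply: subring_stilde => //; case: oT.
(* The v-operation serves as [star'], since its [stilde] fixes [T] and a t-linked [T] is linked for
   it. *)
- move=> [hi h]; split=> // T oT hl; have hT := proj1 oT.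
  rewrite -(stilde_vop hT (quotfield_overring hK oT)).
  apply: h => //; first exact: semistar_vop.
  by apply: gvclosed_linked_vop => //; apply: linked_top_gvclosed.
- by move=> [hi h]; split=> // T oT hl; apply: h => //; apply: linked_dop.
- move=> [hi h]; apply: loc_valuation_PstarMD => // Q.
  exact: dlinked_seminormal_loc_valuation.
- move=> h T star' oT hs' hl; apply: stilde_integrally_closed => N hN.
  apply: valuation_integrally_closed; last exact: PstarMD_loc_valuation oT hs' hl hN.
  have hT := proj1 oT; apply: subring_loc_prime => //.
  exact: quasi_prime_ideal (quasi_max_prime hT hs' hN).
Qed.
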